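(* If all agents have super-additive valuations, then there exists a mechanism that makes a polynomial number (in $n$ and $m$) of value queries and outputs a combinatorial Walrasian equilibrium (CWE) outcome whose social welfare is within a factor $O(m/\sqrt{\log m})$ of the optimal social welfare.
   Context: $M$ is a finite set of $m$ indivisible items and $[n]$ a set of agents with monotone valuations $v_i:2^M\to\mathbb{R}_{\ge0}$, $v_i(\emptyset)=0$; super-additive means $v(S\cup T)\ge v(S)+v(T)$ for disjoint $S,T$. An allocation is a tuple $(x_0,\dots,x_n)$ of pairwise disjoint sets with union $M$ ($x_0$ unallocated). An allocation with prices $p_k\ge 0$ for each nonempty bundle $x_k$ is a CWE outcome if for every agent $i$ and every set $T$ of indices of nonempty bundles, $u_i\ge v_i(\bigcup_{k\in T}x_k)-\sum_{k\in T}p_k$, where $u_i=v_i(x_i)-p_i$ if $x_i\neq\emptyset$ and $0$ otherwise. A value query asks an agent $i$ for $v_i(S)$ for a given set $S$. Social welfare is $\sum_{i=1}^n v_i(x_i)$. *)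

(* Defs.v *)
From HB Require Import structures.
From mathcomp Require Import all_boot all_order all_algebra.
From mathcomp Require Import reals exp.
Set Implicit Arguments. Unset Strict Implicit. Unset Printing Implicit Defensive.
Import Order.TTheory GRing.Theory Num.Theory.
Local Open Scope ring_scope.

(* Agents are 'I_n, items are 'I_m.  Bundle indices are option 'I_n:
   None is the unallocated bundle x_0, Some i is agent i's bundle x_i. *)

Definition allocation (n m : nat) := {ffun 'I_m -> option 'I_n}.

Definition bundle n m (x : allocation n m) (k : option 'I_n) : {set 'I_m} :=
  [set j | x j == k].

Definition valuations (R : realType) (n m : nat) := 'I_n -> {set 'I_m} -> R.

Definition valid_valuation (R : realType) m (v : {set 'I_m} -> R) : Prop :=
  v set0 = 0 /\ (forall S, 0 <= v S) /\
  (forall S T : {set 'I_m}, S \subset T -> v S <= v T).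

Definition superadditive (R : realType) m (v : {set 'I_m} -> R) : Prop :=
  forall S T : {set 'I_m}, [disjoint S & T] -> v S + v T <= v (S :|: T).

(* An outcome: allocation plus a price for each bundle index
   (only prices of nonempty bundles matter). *)
Definition outcome (R : realType) n m := (allocation n m * (option 'I_n -> R))%type.

Definition utility (R : realType) n m (v : valuations R n m)
  (x : allocation n m) (p : option 'I_n -> R) (i : 'I_n) : R :=
  if bundle x (Some i) != set0 then v i (bundle x (Some i)) - p (Some i) else 0.

Definition is_CWE (R : realType) n m (v : valuations R n m)
  (x : allocation n m) (p : option 'I_n -> R) : Prop :=
  (forall k, bundle x k != set0 -> 0 <= p k) /\
  (forall (i : 'I_n) (T : {set option 'I_n}),
     (forall k, k \in T -> bundle x k != set0) ->
     v i (\bigcup_(k in T) bundle x k) - \sum_(k in T) p k <= utility v x p i).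

Definition social_welfare (R : realType) n m (v : valuations R n m)
  (x : allocation n m) : R :=
  \sum_(i < n) v i (bundle x (Some i)).

(* Value-query algorithms: adaptive decision trees whose internal nodes ask
   agent i for v_i(S) and branch on the (real) answer. *)
Inductive qtree (n m : nat) (R A : Type) : Type :=
| Ret : A -> qtree n m R A
| Query : 'I_n -> {set 'I_m} -> (R -> qtree n m R A) -> qtree n m R A.

Fixpoint run (n m : nat) (R A : Type) (v : 'I_n -> {set 'I_m} -> R)
  (t : qtree n m R A) : A * nat :=
  match t with
  | Ret a => (a, 0%N)
  | Query i B k => let r := run v (k (v i B)) in (r.1, r.2.+1)
  end.

(* Main.v *)
(** Cut the items into about log m consecutive blocks of nearly equal size.  There
    are only O(m) unions of blocks, so every agent can be asked for the value of
    each of them, and the mechanism picks an allocation of whole blocks of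
    maximal welfare W.  Pricing each bundle at its owner's value makes this a CWE:
    no agent can be offered a set of bundles worth more to her than the sum of
    the owners' values, since adding it to her own bundle would, by
    superadditivity, raise the welfare.

    To compare W with an arbitrary allocation y, put r = sqrt (log m).  At most m / r
    agents receive more than r items in y, each contributing at most W.  A bundle with
    at most r items meets at most r blocks, hence conflicts with O(r * m / log m)
    = O(m / r) other bundles, so a greedy choice of pairwise non-conflicting
    bundles retains a fraction r / O(m) of the value of the small bundles, and it
    extends to an allocation of whole blocks. *)

Require Import Defs.
From HB Require Import structures.
From mathcomp Require Import all_boot all_order all_algebra.
From mathcomp Require Import reals sequences exp.
Set Implicit Arguments. Unset Strict Implicit. Unset Printing Implicit Defensive.
Import Order.TTheory GRing.Theory Num.Theory.
Local Open Scope ring_scope.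

(** * Asking a fixed list of value queries *)

Fixpoint query_all (n m : nat) (R A : Type) (l : seq ('I_n * {set 'I_m}))
    (f : ('I_n -> {set 'I_m} -> R) -> A) (acc : 'I_n -> {set 'I_m} -> R) :
    qtree n m R A :=
  if l is (i, D) :: l' then
    Query i D (fun r => query_all l' f
      (fun i' D' => if (i', D') == (i, D) then r else acc i' D'))
  else Ret n m R (f acc).

(** The disjunct on [acc] carries the induction: a pair already answered keeps its true value, even
    if it is asked again. *)
Lemma run_query_all (n m : nat) (R A : Type) (v : 'I_n -> {set 'I_m} -> R)
    (l : seq ('I_n * {set 'I_m})) (f : ('I_n -> {set 'I_m} -> R) -> A)
    (acc : 'I_n -> {set 'I_m} -> R) :
  exists2 w, run v (query_all l f acc) = (f w, size l) &
    forall i D, (i, D) \in l \/ acc i D = v i D -> w i D = v i D.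
Proof.
elim: l acc => [|[i D] l IH] acc /=.
  by exists acc => // i D [].
have [w -> hw] := IH (fun i' D' => if (i', D') == (i, D) then v i D else acc i' D').
exists w => // i' D'; rewrite inE => h; apply: hw.
case: ifP h => [/eqP[-> ->] _|_ /= [h|h]]; by [right|left].
Qed.

(** * Allocations of whole blocks *)

Section Coarsening.
Variables (R : realType) (n m : nat) (B : finType) (blk : 'I_m -> B).

Definition coarsen (z : {ffun B -> option 'I_n}) : allocation n m :=
  [ffun j => z (blk j)].

(** The unallocated bundle can be free: when [x] is optimal among coarse allocations, it is worth
    nothing to a superadditive agent. *)
Definition bundle_prices (v : valuations R n m) (x : allocation n m)
    (k : option 'I_n) : R :=
  if k is Some i then v i (bundle x (Some i)) else 0.

Lemma bundle_coarsen z k : bundle (coarsen z) k = blk @^-1: [set b | z b == k].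
Proof. by apply/setP => j; rewrite !inE ffunE. Qed.

Lemma sum_option_prices (v : valuations R n m) x (T : {set option 'I_n}) :
  \sum_(k in T) bundle_prices v x k =
  \sum_(i < n | Some i \in T) v i (bundle x (Some i)).
Proof.
rewrite big_mkcond (bigD1 None) //= if_same add0r.
rewrite (reindex_omap Some id) /=; last by case.
by rewrite [RHS]big_mkcond; apply: eq_big => // i; rewrite eqxx.
Qed.

(* Reassigning the bundles in [T] to agent [i] cannot raise the welfare, and
   superadditivity makes the marginal gain of [i] at least her value of [T]. *)
Lemma optimal_coarse_CWE (v : valuations R n m) z p :
  (forall i, valid_valuation (v i)) -> (forall i, superadditive (v i)) ->
  (forall z', social_welfare v (coarsen z') <= social_welfare v (coarsen z)) ->
  p =1 bundle_prices v (coarsen z) -> is_CWE v (coarsen z) p.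
Proof.
move=> vv vs opt pE; set x := coarsen z.
split=> [k _|i T _]; first by rewrite pE; case: k => [i|] //=; have [_ []] := vv i.
set U := \bigcup_(k in T) _.
have -> : utility v x p i = 0.
  by rewrite /utility pE subrr if_same.
rewrite subr_le0 (eq_bigr _ (fun k _ => pE k)) sum_option_prices.
pose z' := [ffun b => if z b \in T then Some i else z b].
pose x' := coarsen z'.
have U_in j : (j \in U) = (x j \in T).
  apply/bigcupP/idP => [[k kT]|xT]; first by rewrite inE => /eqP ->.
  by exists (x j); rewrite ?inE.
have x'E j : x' j = if x j \in T then Some i else x j by rewrite !ffunE.
(* If [Some i \in T], the old bundle of [i] is already part of [U]; otherwise it is disjoint from
   [U] and superadditivity applies. *)
have term k : (if Some k \in T then 0 else v k (bundle x (Some k))) +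
    (if k == i then v i U else 0) <= v k (bundle x' (Some k)).
  case: (eqVneq k i) => [->|ki].
    case: ifPn => iT.
      rewrite add0r; have [_ [_ mono]] := vv i; apply: mono.
      by apply/subsetP => j; rewrite U_in inE x'E => ->.
    apply: (le_trans (vs i _ _ _)).
      rewrite -setI_eq0; apply/eqP/setP => j; rewrite in_setI U_in !inE.
      by apply/negbTE/andP => -[/eqP ->]; apply/negP.
    have [_ [_ mono]] := vv i; apply: mono; apply/subsetP => j.
    by rewrite in_setU U_in !inE x'E => /orP[/eqP ->|->] //; rewrite (negbTE iT).
  rewrite addr0; case: ifPn => kT; first by have [_ []] := vv k.
  have [_ [_ mono]] := vv k; apply: mono; apply/subsetP => j.
  by rewrite !inE x'E => /eqP ->; rewrite (negbTE kT).
have := le_trans (ler_sum _ (fun k _ => term k)) (opt z').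
rewrite big_split /= -[X in _ + X]big_mkcond /= big_pred1_eq.
rewrite /social_welfare (bigID (fun k => Some k \in T)) /= big1; last by move=> k ->.
rewrite add0r [leRHS](bigID (fun k => Some k \in T)) /= addrC.
under [X in _ + X <= _]eq_bigr => k kT do rewrite (negbTE kT).
by rewrite lerD2r.
Qed.

Lemma sum_card_bundle (y : allocation n m) :
  (\sum_(i < n) #|bundle y (Some i)| <= m)%N.
Proof.
under eq_bigr => i _ do rewrite -sum1_card big_mkcond.
rewrite exchange_big /= -[X in (_ <= X)%N]card_ord -sum1_card; apply: leq_sum => j _.
case yj: (y j) => [i0|]; last by rewrite big1 // => i _; rewrite inE yj.
rewrite -big_mkcond (big_pred1 i0) // => i; rewrite inE yj eq_sym.
by apply/eqP/eqP => [[]|->].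
Qed.

(** Every conflicting agent owns an item in a block met by bundle [i], and each item has one owner,
    so it suffices to count the items in those blocks. *)
Lemma card_conflicts (y : allocation n m) (i : 'I_n) (s : nat) :
  (forall b, #|blk @^-1: [set b]| <= s)%N ->
  (#|[set j | ~~ [disjoint blk @: bundle y (Some i) & blk @: bundle y (Some j)]]|
     <= #|bundle y (Some i)| * s)%N.
Proof.
move=> hs; set N := [set _ | _]; set X := blk @: bundle y (Some i).
have Xle : (#|blk @^-1: X| <= #|X| * s)%N.
  rewrite -sum1_card (partition_big blk (mem X)) /=; last by move=> j; rewrite inE.
  rewrite -sum_nat_const; apply: leq_sum => b bX.
  rewrite sum1_card; apply: leq_trans (hs b); apply: subset_leq_card.
  by apply/subsetP => j; rewrite !inE => /andP[].
apply: (@leq_trans (#|X| * s)); last by rewrite leq_mul2r leq_imset_card orbT.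
apply: leq_trans Xle; rewrite -(card_imset (mem N) (@Some_inj _)).
apply: leq_trans (leq_imset_card y _); apply: subset_leq_card.
apply/subsetP => _ /imsetP[j jN ->]; move: jN; rewrite inE => /pred0Pn[b /= /andP[bX]].
case/imsetP => a; rewrite inE => /eqP ya bE; apply/imsetP; exists a => //.
by rewrite inE -bE.
Qed.

End Coarsening.

(** * Comparison with an arbitrary allocation *)

(** Keep the heaviest [i] in [A], discard its neighbours, of total weight at most [D * w i], and
    recurse. Reflexivity is asked only on [A] because an empty bundle does not conflict with
    itself. *)
Lemma greedy_independent (R : realDomainType) (I : finType) (e : rel I)
    (w : I -> R) (D : R) (A : {set I}) :
  {in A, forall i, e i i} -> symmetric e -> (forall i, 0 <= w i) ->
  (forall i, i \in A -> #|[set j | e i j]|%:R <= D) ->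
  exists J : {set I}, [/\ J \subset A, {in J &, forall i j, e i j -> i = j} &
    \sum_(i in A) w i <= D * \sum_(i in J) w i].
Proof.
move=> er es w0; move: {2}_.+1 (ltnSn #|A|) => N.
elim: N A er => // N IH A er AN deg.
case: (set_0Vmem A) => [->|[i0 i0A]].
  by exists set0; rewrite !big_set0 mulr0; split=> // i j; rewrite inE.
case: (arg_maxP w i0A) => i mem_iA imax; have iA : i \in A := mem_iA.
have sub : A :\: [set j | e i j] \subset A by apply: subsetDl.
have lt : (#|A :\: [set j | e i j]| < N)%N.
  rewrite -ltnS; apply: leq_trans AN; rewrite ltnS; apply: proper_card.
  by apply/properP; split=> //; exists i => //; rewrite !inE er.
have [||J [JA Jind Jw]] := IH _ _ lt.
- by move=> j /(subsetP sub); exact: er.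
- by move=> j /(subsetP sub); exact: deg.
have iJ j : j \in J -> e i j = false.
  by move=> /(subsetP JA); rewrite !inE => /andP[/negbTE].
have iNJ : i \notin J by apply/negP => /iJ; rewrite er.
exists (i |: J); split.
- by rewrite subUset sub1set iA (subset_trans JA sub).
- move=> j k; rewrite !inE => /orP[/eqP ->|jJ] /orP[/eqP ->|kJ] //.
  + by rewrite iJ.
  + by rewrite es iJ.
  + exact: Jind.
rewrite big_setU1 //= mulrDr (big_setID [set j | e i j]) /= lerD //.
apply: (@le_trans _ _ (#|[set j | e i j]|%:R * w i)); last by rewrite ler_wpM2r ?deg.
rewrite mulr_natl -sumr_const [leRHS](big_setID A) /= setIC -[leLHS]addr0 lerD //.
  by apply: ler_sum => j; rewrite inE => /andP[_ jA]; exact: imax.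
by apply: sumr_ge0.
Qed.

Lemma coarse_welfare_bound (R : realType) (n m : nat) (B : finType)
    (blk : 'I_m -> B) (v : valuations R n m) (W r : R) (s : nat)
    (y : allocation n m) :
  (forall i, valid_valuation (v i)) ->
  (forall z, social_welfare v (coarsen blk z) <= W) ->
  (forall b, #|blk @^-1: [set b]| <= s)%N -> 0 < r ->
  social_welfare v y <= (m%:R / r + r * s%:R) * W.
Proof.
move=> vv hW hs r0; set b := fun i : 'I_n => bundle y (Some i).
have v0 i D : 0 <= v i D by have [_ []] := vv i.
have W0 : 0 <= W by apply: le_trans (hW [ffun=> None]); apply: sumr_ge0.
have vW i : v i (b i) <= W.
  apply: le_trans (hW [ffun=> Some i]); rewrite /social_welfare (bigD1 i) //=.
  rewrite ler_wpDr ?sumr_ge0 //; have [_ [_ mono]] := vv i; apply: mono.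
  by apply/subsetP => j _; rewrite inE !ffunE.
pose big i := r < #|b i|%:R.
rewrite /social_welfare (bigID big) /= mulrDl lerD //.
  (* A large bundle has [1 <= #|b i| / r], so its value is at most [W / r * #|b i|]. *)
  have -> : m%:R / r * W = (W / r) * m%:R by rewrite mulrC [_ / r]mulrC mulrA.
  apply: (@le_trans _ _ (W / r * (\sum_(i < n) #|b i|)%N%:R)); last first.
    by rewrite ler_wpM2l ?divr_ge0 ?(ltW r0) // ler_nat sum_card_bundle.
  rewrite natr_sum mulr_sumr [leRHS](bigID big) /= ler_wpDr //.
    by apply: sumr_ge0 => i _; rewrite mulr_ge0 ?divr_ge0 ?(ltW r0).
  apply: ler_sum => i ib; apply: le_trans (vW i) _.
  by rewrite mulrAC ler_pdivlMr // ler_wpM2l // ltW.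
pose A := [set i | ~~ big i && (b i != set0)].
have -> : \sum_(i < n | ~~ big i) v i (b i) = \sum_(i in A) v i (b i).
  rewrite (bigID (fun i => b i == set0)) /= big1 ?add0r.
    by apply: eq_bigl => i; rewrite inE.
  by move=> i /andP[_ /eqP ->]; have [] := vv i.
pose e i j := ~~ [disjoint blk @: b i & blk @: b j].
have [|||i|J [_ Jind /le_trans]] :=
  @greedy_independent _ _ e (fun i => v i (b i)) (r * s%:R) A.
- move=> i; rewrite inE => /andP[_ /set0Pn[j jb]].
  by apply/pred0Pn; exists (blk j); rewrite /= imset_f.
- by move=> i j; rewrite /e disjoint_sym.
- by [].
- rewrite inE -leNgt => /andP[ib _].
  apply: (@le_trans _ _ (#|b i| * s)%N%:R); first by rewrite ler_nat card_conflicts.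
  by rewrite natrM ler_wpM2r.
apply; rewrite ler_wpM2l ?mulr_ge0 ?(ltW r0) //.
(* Independence of [J] makes the picked agent unique, so each [i] in [J] receives all blocks that
   [b i] meets. *)
pose z := [ffun c => [pick i in J | c \in blk @: b i]].
apply: le_trans (hW z); rewrite /social_welfare [leRHS](bigID (mem J)) /= ler_wpDr ?sumr_ge0 //.
apply: ler_sum => i iJ; have [_ [_ mono]] := vv i; apply: mono.
apply/subsetP => j jb; rewrite inE !ffunE.
have jbi : blk j \in blk @: b i by rewrite imset_f.
case: pickP => [k /andP[kJ kb]|/(_ i)]; last by rewrite iJ jbi.
apply/eqP; congr Some; apply: Jind => //.
by apply/pred0Pn; exists (blk j); rewrite /= kb.
Qed.

(** * The block mechanism and its ratio *)

(** The outer successor makes the blocks cover all items, so [inord] in [block] always receives an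
    index in range. *)
Definition block_size (m : nat) := (m %/ (trunc_log 2 m).+1).+1.

Definition block (m : nat) (j : 'I_m) : 'I_(trunc_log 2 m).+1 :=
  inord (j %/ block_size m).

Lemma card_block (m : nat) b : (#|@block m @^-1: [set b]| <= block_size m)%N.
Proof.
rewrite -[leqRHS]card_ord.
pose f (j : 'I_m) : 'I_(block_size m) := inord (j %% block_size m).
rewrite -(@card_in_imset _ _ f) ?max_card // => i j.
rewrite !inE => /eqP <- /eqP /(congr1 val) bij /(congr1 val).
have quo (h : 'I_m) : (h %/ block_size m < (trunc_log 2 m).+1)%N.
  rewrite ltn_divLR // mulnC; apply: leq_trans (ltn_ord h) _.
  by apply: ltnW; apply: ltn_ceil.
move: bij; rewrite /= !inordK ?ltn_mod //= => bij eij; apply: val_inj => /=.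
by rewrite (divn_eq i (block_size m)) -bij eij -divn_eq.
Qed.

Definition block_queries (n m : nat) : seq ('I_n * {set 'I_m}) :=
  [seq (i, @block m @^-1: X) |
    i : 'I_n <- enum 'I_n,
    X : {set 'I_(trunc_log 2 m).+1} <- enum {set 'I_(trunc_log 2 m).+1}].

Lemma size_block_queries (n m : nat) :
  (size (block_queries n m) <= 2 * (n + m).+1 ^ 2)%N.
Proof.
rewrite size_allpairs -!cardE card_ord -cardsT -powersetT card_powerset cardsT card_ord.
have pow : (2 ^ trunc_log 2 m <= m.+1)%N.
  by case: m => // m; apply: leqW; exact: trunc_logP.
rewrite expnS mulnCA leq_mul2l /= -mulnn; apply: leq_mul; first by rewrite leqW ?leq_addr.
by apply: leq_trans pow _; rewrite ltnS leq_addl.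
Qed.

Definition best_blocks (R : realType) (n m : nat) (w : valuations R n m) :
    {ffun 'I_(trunc_log 2 m).+1 -> option 'I_n} :=
  [arg max_(z > [ffun=> None]) social_welfare w (coarsen (@block m) z)]%O.

Definition block_outcome (R : realType) (n m : nat) (w : valuations R n m) :
    outcome R n m :=
  let x := coarsen (@block m) (best_blocks w) in (x, bundle_prices w x).

Definition block_mechanism (R : realType) (n m : nat) :
    qtree n m R (outcome R n m) :=
  query_all (block_queries n m) (@block_outcome R n m) (fun _ _ => 0).

Lemma block_ratio (R : realType) (m : nat) : (2 <= m)%N ->
  m%:R / Num.sqrt (trunc_log 2 m).+1%:R
    + Num.sqrt (trunc_log 2 m).+1%:R * (block_size m)%:R <= 3 * (m%:R / Num.sqrt (ln m%:R)) :> R.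
Proof.
move=> m2; set K := (trunc_log 2 m).+1; set r := Num.sqrt K%:R.
have K0 : 0 < K%:R :> R by rewrite ltr0n.
have r0 : 0 < r by rewrite sqrtr_gt0.
have rr : r * r = K%:R by rewrite -expr2 sqr_sqrtr ?ltW.
have m0 : 0 < m%:R :> R by rewrite ltr0n ltnW.
have Km : (K <= m)%N.
  by apply: leq_trans (ltn_expl _ _) (trunc_logP _ _) => //; apply: ltnW.
(* Multiplied by [r], the left side is [K * (m %/ K) + K], at most [m + m]. *)
have sK : r * (block_size m)%:R <= 2 * (m%:R / r).
  rewrite mulrA ler_pdivlMr // mulrAC rr -!natrM ler_nat.
  by rewrite mulnS mul2n -addnn leq_add // mulnC leq_divM.
have lnm : 0 < ln (m%:R : R) by rewrite ln_gt0 // ltr1n.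
(* [m <= 2 ^ K], and [2 <= expR 1]. *)
have lnK : ln (m%:R : R) <= K%:R.
  rewrite -[leRHS]expRK ler_ln ?posrE ?expR_gt0 //.
  apply: (@le_trans _ _ (2 ^ K)%N%:R); first by rewrite ler_nat ltnW // trunc_log_ltn.
  rewrite -[K%:R]mulr1 expRM_natl natrX lerXn2r ?nnegrE ?expR_ge0 //.
  by apply: le_trans (expR_ge1Dx 1).
have : m%:R / r <= m%:R / Num.sqrt (ln m%:R).
  by rewrite ler_pM2l // lef_pV2 ?posrE ?sqrtr_gt0 // ler_sqrt // ltW.
move=> le_r; apply: le_trans (lerD (lexx _) sK) _.
by rewrite -{1}[m%:R / r]mul1r -mulrDl nat1r ler_wpM2l.
Qed.

Theorem theorem3 (R : realType) :
  exists (M : forall n m : nat, qtree n m R (outcome R n m)) (c d : nat) (C : R),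
  forall (n m : nat) (v : valuations R n m),
    (forall i, valid_valuation (v i)) ->
    (forall i, superadditive (v i)) ->
    let o := (run v (M n m)).1 in
    let q := (run v (M n m)).2 in
    (q <= c * (n + m).+1 ^ d)%N /\
    is_CWE v o.1 o.2 /\
    ((2 <= m)%N -> forall y : allocation n m,
       social_welfare v y <=
         C * (m%:R / Num.sqrt (ln (m%:R : R))) * social_welfare v o.1).
Proof.
exists (@block_mechanism R), 2%N, 2%N, 3 => n m v vv vs.
have [w -> /= agree] :=
  run_query_all v (block_queries n m) (@block_outcome R n m) (fun _ _ => 0).
have wE i (X : {set 'I_(trunc_log 2 m).+1}) : w i (@block m @^-1: X) = v i (@block m @^-1: X).
  apply: agree; left.
  by apply/allpairsP; exists (i, X) => /=; split=> //; rewrite mem_enum.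
have swE z : social_welfare w (coarsen (@block m) z) =
             social_welfare v (coarsen (@block m) z).
  by apply: eq_bigr => i _; rewrite bundle_coarsen wE.
have opt z : social_welfare v (coarsen (@block m) z) <=
             social_welfare v (coarsen (@block m) (best_blocks w)).
  by rewrite -!swE /best_blocks; case: arg_maxP => // z' _; apply.
split; first exact: size_block_queries.
split.
  (* The prices come from the answer table [w], which agrees with [v] on unions of blocks. *)
  apply: optimal_coarse_CWE => // -[i|] //=.
  by rewrite bundle_coarsen wE.
move=> m2 y.
have r0 : 0 < Num.sqrt (trunc_log 2 m).+1%:R :> R by rewrite sqrtr_gt0 ltr0n.
apply: le_trans (coarse_welfare_bound y vv opt (@card_block m) r0) _.
rewrite ler_wpM2r ?block_ratio //.
by apply: sumr_ge0 => i _; have [_ []] := vv i.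
Qed.
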